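(* Let $X$ be a graph. There is a constant $\eta>0$ (depending on $X$) such that for all vertices $a,b$ of $X$: if for some $t$ we have $\|D_a(t)-D_b\|<\eta$, then $a$ and $b$ are strongly cospectral.
   Context: Graphs are finite, simple and undirected. Let $A$ be the adjacency matrix of $X$ and let $U(t)=\exp(itA)$ for real $t\ge 0$, with $U(-t)=\exp(-itA)$. Let $e_a$ ($a\in V(X)$) be the standard basis vectors of $\mathbb{C}^{V(X)}$, let $D_a=e_ae_a^T$, and let $D_a(t)=U(t)D_aU(-t)$. The norm of a matrix is $\|M\|=\operatorname{tr}(M^*M)^{1/2}$. Let $E_r$ denote the orthogonal projections onto the distinct eigenspaces of $A$. Vertices $a,b$ are strongly cospectral if for each $r$ we have $E_re_a=E_re_b$ or $E_re_a=-E_re_b$. *)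

(* Defs.v *)
From HB Require Import structures.
From mathcomp Require Import all_boot all_order all_algebra.
From mathcomp Require Import complex.
From mathcomp Require Import all_classical all_reals all_analysis.

Set Implicit Arguments.
Unset Strict Implicit.
Unset Printing Implicit Defensive.

Import Order.TTheory GRing.Theory Num.Theory.
Import numFieldNormedType.Exports.

Local Open Scope ring_scope.
Local Open Scope complex_scope.
Local Open Scope sesquilinear_scope.

(* The limit is taken in the entrywise topology of 'M[C]_n, where C carries
   the topology of its norm. *)
Definition expmx (C : numFieldType) (n : nat) (M : 'M[C]_n) : 'M[C]_n :=
  limn (series (fun k : nat => (k`!%:R)^-1 *: M ^+ k)).

Definition mxnorm_tr (C : numClosedFieldType) (m n : nat) (M : 'M[C]_(m, n)) : C :=
  sqrtC (\tr (M^t* *m M)).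

(* MathComp eigenspaces and projections act on row vectors, from the right;
   the transpositions give the matrix that acts on column vectors as the
   orthogonal projection onto {v | A v = theta v}. *)
Definition eigenproj (C : numClosedFieldType) (n : nat) (A : 'M[C]_n) (theta : C)
  : 'M[C]_n :=
  (proj_ortho (eigenspace A^T theta))^T.

(* A graph on the finite vertex type T is given by its adjacency relation e.
   Matrices indexed by T are indexed by 'I_#|T| through enum_rank. *)
Section Graph.

Variables (R : realType) (T : finType) (e : rel T).

Local Notation C := R[i].

Definition adjmx : 'M[C]_#|T| :=
  \matrix_(i, j) (e (enum_val i) (enum_val j))%:R.

Definition vtx (a : T) : 'cV[C]_#|T| := delta_mx (enum_rank a) 0.

Definition vtx_state (a : T) : 'M[C]_#|T| := vtx a *m (vtx a)^T.

Definition transmx (t : R) : 'M[C]_#|T| := expmx (('i * t%:C) *: adjmx).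

Definition vtx_state_at (a : T) (t : R) : 'M[C]_#|T| :=
  transmx t *m vtx_state a *m transmx (- t).

Definition strongly_cospectral (a b : T) : Prop :=
  forall theta : C, eigenvalue adjmx theta ->
    eigenproj adjmx theta *m vtx a = eigenproj adjmx theta *m vtx b \/
    eigenproj adjmx theta *m vtx a = - (eigenproj adjmx theta *m vtx b).

End Graph.

(* Main.v *)
Require Import Defs.
From mathcomp Require Import all_boot all_order all_algebra.
From mathcomp Require Import complex.
From mathcomp Require Import all_classical all_reals all_analysis.
From mathcomp Require Import ring.

Set Implicit Arguments.
Unset Strict Implicit.
Unset Printing Implicit Defensive.

Import Order.TTheory GRing.Theory Num.Theory.
Import numFieldNormedType.Exports.

Local Open Scope ring_scope.
Local Open Scope complex_scope.
Local Open Scope classical_set_scope.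
Local Open Scope sesquilinear_scope.

(** Let [E] be the orthogonal projection onto the eigenspace of [A] for an
    eigenvalue [theta]. On that eigenspace [U(t)] is the scalar
    [exp (i t theta)], so [E U(t)] and [U(-t) E] are multiples of [E] by
    two phases that cancel:

      [E D_a(t) E = E D_a E]   for every [t]      ([compress_evolution]).

    Hence [E (D_a(t) - D_b) E = E (D_a - D_b) E], and since compressing by an
    orthogonal projection does not increase the trace norm
    ([mxnorm_tr_compress]),

      [|| E (D_a - D_b) E || <= || D_a(t) - D_b ||].

    The left-hand side takes finitely many values as [theta], [a] and [b] vary.
    Choose [eta] to be at most all of those that are nonzero
    ([eq0_of_small]): then [|| D_a(t) - D_b || < eta] forces
    [E D_a E = E D_b E]. As [A] and [theta] are real, [E] is not only Hermitian
    but symmetric ([eigenproj_symmetric]), so that this equation reads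
    [x x^T = y y^T] with [x = E e_a] and [y = E e_b], whence [x = y] or
    [x = - y] ([outer_square_eq]).

    The exponential is defined as the sum of a series of matrices. It is
    evaluated by diagonalising [A], which turns the series into the scalar
    exponential series on the diagonal; at the imaginary argument [i s] that
    series is the sum of the cosine and [i] times the sine series
    ([cvg_phase]). *)

(** * The phase exp(is) as the sum of its series *)

Section RealToComplex.
Variable R : realType.
Local Notation C := (R[i] : numClosedFieldType).

Lemma cvg_real_complex (u : nat -> R) (l : R) :
  u @ \oo --> l -> (fun n => (u n)%:C : C) @ \oo --> (l%:C : C).
Proof.
move=> ul; apply/cvgrPdist_lt => eps eps0.
have er : (complex.Re eps)%:C = eps by rewrite RRe_real ?gtr0_real.
have : 0 < complex.Re eps by rewrite -ltcR er.
move/cvgrPdist_lt: ul => /[apply]; apply: filterS => n h.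
rewrite -er -rmorphB normc_def /= expr0n addr0 sqrtr_sqr.
by rewrite ltcR.
Qed.

(** The complex number [exp (i s)]. *)
Definition phase (s : R) : C := (cos s)%:C + 'i * (sin s)%:C.

Lemma phaseN s : phase s * phase (- s) = 1.
Proof.
rewrite /phase cosN sinN rmorphN /= mulrN mulrC -subr_sqr exprMn sqrCi mulN1r opprK.
by rewrite -!rmorphXn -rmorphD /= cos2Dsin2.
Qed.

Lemma expr_i (k : nat) : 'i ^+ k = ((~~ odd k)%:R * (-1) ^+ k./2 : R)%:C
   + 'i * ((odd k)%:R * (-1) ^+ k.-1./2 : R)%:C :> C.
Proof.
rewrite -[in LHS](odd_double_half k).
rewrite exprD -mul2n exprM sqrCi; case: (boolP (odd k)) => [ko|ke]; last first.
  by rewrite mul0r mulr0 addr0 !mul1r rmorphXn rmorphN1.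
rewrite mul0r add0r mul1r expr1 rmorphXn rmorphN1.
by have -> : k.-1./2 = k./2 by rewrite -{1}(odd_double_half k) ko /= doubleK.
Qed.

Lemma exp_coeff_phase (s : R) k :
  (k`!%:R)^-1 * ('i * s%:C) ^+ k
  = (cos_coeff s k)%:C + 'i * (sin_coeff s k)%:C :> C.
Proof.
rewrite exprMn expr_i /cos_coeff /sin_coeff /= -exprnP !rmorphM /= !rmorphV /=.
  rewrite ?rmorphXn /= ?rmorph_nat; ring.
by rewrite unitfE pnatr_eq0 -lt0n fact_gt0.
Qed.

Lemma cvg_phase (s : R) :
  series (fun k => (k`!%:R)^-1 * ('i * s%:C) ^+ k : C) @ \oo --> phase s.
Proof.
rewrite (_ : series _ = fun n => (series (cos_coeff s) n)%:C
    + 'i * (series (sin_coeff s) n)%:C); last first.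
  apply/funext => n; rewrite /series /= !rmorph_sum /= mulr_sumr -big_split /=.
  by apply: eq_bigr => k _; exact: exp_coeff_phase.
apply: cvgD.
  by apply: cvg_real_complex; rewrite unlock; exact: is_cvg_series_cos_coeff.
apply: cvgMl_tmp.
by apply: cvg_real_complex; rewrite unlock; exact: is_cvg_series_sin_coeff.
Qed.
End RealToComplex.

(** * Exponential of a diagonalised matrix *)

Lemma cvg_matrix (K : numFieldType) m n (u : nat -> 'M[K]_(m, n)) (L : 'M[K]_(m, n)) :
  (forall i j, (fun k => u k i j) @ \oo --> L i j) -> u @ \oo --> L.
Proof.
move=> uL A [P LP PA]; apply: (@filterS _ (u @ \oo) _ _ _ PA).
apply: (@filter_forall _ _ _ (u @ \oo)) => i.
apply: (@filter_forall _ _ _ (u @ \oo)) => j.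
exact: (uL i j _ (LP i j)).
Qed.

(** Entries are continuous functions of a matrix, so the limit is unique because
    the limit of each entry is. *)
Lemma matrix_lim (K : numFieldType) m n (u : nat -> 'M[K]_(m, n)) (L : 'M[K]_(m, n)) :
  u @ \oo --> L -> lim (u @ \oo) = L.
Proof.
move=> uL; have ul : cvg (u @ \oo) by apply/cvg_ex; exists L.
apply/matrixP => i j.
have e (M : 'M[K]_(m, n)) : u @ \oo --> M -> (fun k => u k i j) @ \oo --> M i j.
  by move=> uM; exact: (cvg_comp u (fun N : 'M[K]_(m, n) => N i j) uM
    (@coord_continuous _ _ _ i j M)).
by apply: (cvg_unique _ (e _ ul) (e _ uL)).
Qed.

Lemma conj_diag_exp (K : comNzRingType) n (P Q : 'M[K]_n) (d : 'rV[K]_n) (c : K) k :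
  P *m Q = 1%:M -> Q *m P = 1%:M ->
  (c *: (Q *m diag_mx d *m P)) ^+ k
  = Q *m diag_mx (\row_j (c * d 0 j) ^+ k) *m P.
Proof.
move=> PQ QP; elim: k => [|k IH].
  rewrite expr0 (_ : \row_j _ = const_mx 1) ?diag_const_mx ?mulmx1 ?QP //.
  by apply/rowP => j; rewrite !mxE expr0.
rewrite exprS IH -mulmxE -scalemxAl -!mulmxA (mulmxA P Q) PQ mul1mx.
rewrite (mulmxA (diag_mx d)) mulmx_diag scalemxAr scalemxAl.
congr (_ *m (_ *m _)).
by apply/matrixP => i j; rewrite !mxE exprS -mulrnAr mulrA -mulrnAr.
Qed.

(** Each entry of the partial sums is a fixed linear combination of the partial
    sums of the scalar series at the [c * d 0 j]. The limits [f 0 j] stand for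
    [exp (c * d 0 j)]; their existence is left as a hypothesis because the
    convergence over a given field is a matter of completeness. *)
Lemma expmx_diag (K : numFieldType) n (P Q : 'M[K]_n) (d f : 'rV[K]_n) (c : K) :
  P *m Q = 1%:M -> Q *m P = 1%:M ->
  (forall j, series (fun k => (k`!%:R)^-1 * (c * d 0 j) ^+ k) @ \oo --> f 0 j) ->
  expmx (c *: (Q *m diag_mx d *m P)) = Q *m diag_mx f *m P.
Proof.
move=> PQ QP df; apply: matrix_lim; apply: cvg_matrix => i j.
have entry (g : 'rV[K]_n) : (Q *m diag_mx g *m P) i j = \sum_l Q i l * P l j * g 0 l.
  rewrite mxE; apply: eq_bigr => l _; rewrite mul_mx_diag mxE; ring.
rewrite entry (_ : (fun k => _) = fun k => \sum_l Q i l * P l j *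
    series (fun k => (k`!%:R)^-1 * (c * d 0 l) ^+ k) k); last first.
  apply/funext => k; rewrite /series /= summxE.
  under [RHS]eq_bigr do rewrite mulr_sumr.
  rewrite exchange_big; apply: eq_bigr => p _ /=.
  rewrite conj_diag_exp // mxE entry mulr_sumr; apply: eq_bigr => l _.
  rewrite mxE; ring.
apply: cvg_big => [|l _]; first exact: add_continuous.
exact: cvgMl_tmp.
Qed.

(** In the eigenbasis, the rows of [B] have nonzero coordinates only at the [j]
    with [d 0 j = theta], and there [f (d 0 j)] is [f theta]. With [f] the
    exponential, this says that [exp A] acts on the eigenspace as the
    scalar [exp theta]. *)
Lemma eigen_mul_conj_diag (K : idomainType) m n (B : 'M[K]_(m, n)) (P Q : 'M[K]_n)
    (d : 'rV[K]_n) (theta : K) (f : K -> K) :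
  P *m Q = 1%:M -> Q *m P = 1%:M ->
  B *m (Q *m diag_mx d *m P) = theta *: B ->
  B *m (Q *m diag_mx (map_mx f d) *m P) = f theta *: B.
Proof.
move=> PQ QP eB.
(* [B *m Q] holds the coordinates of the rows of [B] in the eigenbasis. *)
have {}eB : B *m Q *m diag_mx d = theta *: (B *m Q).
  by rewrite scalemxAl -eB -!mulmxA PQ mulmx1.
suff e : B *m Q *m diag_mx (map_mx f d) = f theta *: (B *m Q).
  by rewrite !mulmxA e -scalemxAl -mulmxA QP mulmx1.
apply/matrixP => i j; move/matrixP/(_ i j): eB.
rewrite !mul_mx_diag !mxE; set x := \sum_ _ _; rewrite mulrC.
have [->|x0] := eqVneq x 0; first by rewrite !mulr0 mul0r.
by move/(mulIf x0) ->; rewrite mulrC.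
Qed.

(** * Rank-one symmetric matrices *)

(** A nonzero entry [x_i] fixes the sign by [x_i ^ 2 = y_i ^ 2]; the other
    entries then have the same sign because [x_i x_j = y_i y_j]. *)
Lemma outer_square_eq (K : idomainType) n (x y : 'cV[K]_n) :
  x *m x^T = y *m y^T -> x = y \/ x = - y.
Proof.
move=> /matrixP xy.
have {}xy i j : x i 0 * x j 0 = y i 0 * y j 0.
  by have := xy i j; rewrite !mxE !big_ord1 !mxE.
have [x0|/matrix0Pn[i [k]]] := eqVneq x 0; last rewrite (ord1 k) => xi0.
  left; apply/colP => i; move: (xy i i); rewrite x0 mxE mul0r => /esym/eqP.
  by rewrite mulf_eq0 orbb => /eqP.
have := xy i i; move/eqP; rewrite -!expr2 eqf_sqr => /orP[]/eqP xi; [left|right].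
  by apply/colP => j; apply: (mulfI xi0); rewrite xy xi.
by apply/colP => j; apply: (mulfI xi0); rewrite xy xi mxE mulrNN.
Qed.

(** * The trace norm under compression *)

Lemma mxtrace_gram_ge0 (C : numClosedFieldType) m n (M : 'M[C]_(m, n)) :
  0 <= \tr (M^t* *m M).
Proof.
apply: sumr_ge0 => i _; rewrite mxE; apply: sumr_ge0 => j _.
by rewrite !mxE mulrC mul_conjC_ge0.
Qed.

Lemma mxnorm_tr_ge0 (C : numClosedFieldType) m n (M : 'M[C]_(m, n)) :
  0 <= mxnorm_tr M.
Proof. by rewrite sqrtC_ge0 mxtrace_gram_ge0. Qed.

Lemma mxnorm_tr_eq0 (C : numClosedFieldType) m n (M : 'M[C]_(m, n)) :
  mxnorm_tr M = 0 -> M = 0.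
Proof.
move=> /eqP; rewrite sqrtC_eq0 => /eqP M0; apply/matrixP => i j.
have h k : 0 <= (M^t* *m M) k k.
  by rewrite mxE sumr_ge0 // => l _; rewrite !mxE mulrC mul_conjC_ge0.
move/eqP: M0; rewrite psumr_eq0 // => /allP/(_ j); rewrite mem_index_enum => /(_ isT).
rewrite mxE psumr_eq0; last by move=> l _; rewrite !mxE mulrC mul_conjC_ge0.
move=> /allP/(_ i); rewrite mem_index_enum => /(_ isT) /=.
by rewrite !mxE mulrC mul_conjC_eq0 => /eqP.
Qed.

Lemma trmxC_mul (C : numClosedFieldType) m n p (A : 'M[C]_(m, n)) (B : 'M[C]_(n, p)) :
  (A *m B)^t* = B^t* *m A^t*.
Proof. by rewrite trmx_mul map_mxM. Qed.

Lemma mxnorm_trC (C : numClosedFieldType) m n (M : 'M[C]_(m, n)) :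
  mxnorm_tr (M^t*) = mxnorm_tr M.
Proof. by rewrite /mxnorm_tr trmxCK mxtrace_mulC. Qed.

(** Pythagoras: [|| M ||^2 = || E M ||^2 + || M - E M ||^2]. *)
Lemma mxnorm_tr_projl (C : numClosedFieldType) m n (E : 'M[C]_m) (M : 'M[C]_(m, n)) :
  E^t* = E -> E *m E = E -> mxnorm_tr (E *m M) <= mxnorm_tr M.
Proof.
move=> Eh EE; rewrite ler_sqrtC ?nnegrE ?mxtrace_gram_ge0 // -subr_ge0.
suff -> : \tr (M^t* *m M) - \tr ((E *m M)^t* *m (E *m M))
    = \tr ((M - E *m M)^t* *m (M - E *m M)) by exact: mxtrace_gram_ge0.
rewrite -raddfB; congr (\tr _).
have -> : (M - E *m M)^t* = M^t* - (E *m M)^t*.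
  by apply/matrixP => i j; rewrite !mxE rmorphB.
rewrite trmxC_mul Eh mulmxBl !mulmxBr !mulmxA.
by rewrite -(mulmxA _ E E) EE subrr subr0.
Qed.

Lemma mxnorm_tr_compress (C : numClosedFieldType) n (E M : 'M[C]_n) :
  E^t* = E -> E *m E = E -> mxnorm_tr (E *m M *m E) <= mxnorm_tr M.
Proof.
move=> Eh EE; rewrite -mxnorm_trC trmxC_mul Eh.
apply: le_trans (mxnorm_tr_projl _ Eh EE) _.
by rewrite mxnorm_trC; exact: mxnorm_tr_projl.
Qed.

(** * Eigenprojections of a real symmetric matrix *)

(** With [P] the projection, [1 - P] maps into the orthogonal complement of
    the range of [P], so [P *m P^t* = P^t*], and the left-hand side is
    Hermitian. *)
Lemma proj_ortho_hermitian (C : numClosedFieldType) m n (V : 'M[C]_(m, n)) :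
  (proj_ortho V)^t* = proj_ortho V.
Proof.
set P := proj_ortho V.
suff PP : P *m P^t* = P^t*.
  by move/(congr1 (fun A => A^t*)): (PP); rewrite trmxC_mul trmxCK PP.
have : (1%:M - 1%:M *m P) *m P^t* = 0.
  apply/orthomx1P; apply: submx_trans (proj_ortho_compl_sub _ _) _.
  by rewrite submx_ortho /P proj_orthoE.
by rewrite mul1mx mulmxBl mul1mx => /subr0_eq.
Qed.

(** The conjugate [Q] of the projection [P] is again Hermitian with range
    inside [V], so [Q *m P = Q]. Taking adjoints gives [P *m Q = Q], and the
    conjugate of that equation is [Q *m P = P]. *)
Lemma proj_ortho_real (C : numClosedFieldType) m n (V : 'M[C]_(m, n)) :
  (V ^ Num.conj <= V)%MS -> (proj_ortho V) ^ Num.conj = proj_ortho V.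
Proof.
move=> cV; set P := proj_ortho V; set Q := P ^ Num.conj.
have QP : Q *m P = Q.
  by apply: proj_ortho_id; apply: submx_trans cV; rewrite map_submx /P proj_orthoE.
have Ph : P^t* = P by exact: proj_ortho_hermitian.
have Qh : Q^t* = Q by rewrite /Q map_trmx Ph.
have PQ : P *m Q = Q by rewrite -{1}Ph -{1}Qh -trmxC_mul QP Qh.
have : (P *m Q) ^ Num.conj = Q ^ Num.conj by rewrite PQ.
by rewrite map_mxM -/Q {2 3}/Q map_mxCK QP.
Qed.

Section RealSymmetric.
Variables (C : numClosedFieldType) (n : nat) (A : 'M[C]_n).
Hypotheses (A_sym : A^T = A) (A_real : A ^ Num.conj = A).

Lemma real_symmetric_spectral :
  exists (P Q : 'M[C]_n) (d : 'rV[C]_n),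
    [/\ P *m Q = 1%:M, Q *m P = 1%:M, forall j, d 0 j \is Num.real
      & A = Q *m diag_mx d *m P].
Proof.
have Ah : A \is hermsymmx.
  by apply/is_hermitianmxP; rewrite expr0 scale1r A_sym A_real.
have uP := spectral_unit A.
exists (spectralmx A), (invmx (spectralmx A)), (spectral_diag A); split.
- exact: mulmxV.
- exact: mulVmx.
- by move=> j; have /mxOverP := hermitian_spectral_diag_real Ah; exact.
- exact/orthomx_spectralP/hermitian_normalmx.
Qed.

Variable theta : C.
Hypothesis theta_real : theta \is Num.real.
Local Notation E := (eigenproj A theta).

Let eigenproj_proj_ortho :
  E = proj_ortho (eigenspace A theta) /\ E ^ Num.conj = E.
Proof.
rewrite /eigenproj A_sym; set V := eigenspace A theta.
have Pc : (proj_ortho V) ^ Num.conj = proj_ortho V.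
  apply: proj_ortho_real; apply/eigenspaceP.
  rewrite -[in LHS]A_real -map_mxM (eigenspaceP (submx_refl V)) map_mxZ.
  by rewrite /= (CrealP theta_real).
by have := proj_ortho_hermitian V; rewrite -map_trmx Pc => ->.
Qed.

Lemma eigenproj_hermitian : E^t* = E.
Proof. by have [-> _] := eigenproj_proj_ortho; exact: proj_ortho_hermitian. Qed.

(** This is where the reality of [A] and [theta] matters: a Hermitian projection is
    symmetric exactly when it is real. *)
Lemma eigenproj_symmetric : E^T = E.
Proof. by have := eigenproj_hermitian; rewrite -map_trmx eigenproj_proj_ortho.2. Qed.

Lemma eigenproj_idem : E *m E = E.
Proof. by have [-> _] := eigenproj_proj_ortho; exact: proj_ortho_proj. Qed.

Lemma eigenproj_mulmx : E *m A = theta *: E.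
Proof.
have [-> _] := eigenproj_proj_ortho.
by apply/eigenspaceP; rewrite proj_orthoE.
Qed.

Lemma mulmx_eigenproj : A *m E = theta *: E.
Proof.
apply: trmx_inj; rewrite trmx_mul linearZ /= eigenproj_symmetric A_sym.
exact: eigenproj_mulmx.
Qed.

End RealSymmetric.

Lemma eigenvalue_conj_diag (K : fieldType) n (P Q : 'M[K]_n) (d : 'rV[K]_n) theta :
  P *m Q = 1%:M -> Q *m P = 1%:M ->
  eigenvalue (Q *m diag_mx d *m P) theta -> exists j, theta = d 0 j.
Proof.
move=> PQ QP /eigenvalueP[v ev v0].
have {}ev : v *m Q *m diag_mx d = theta *: (v *m Q).
  by rewrite scalemxAl -ev -!mulmxA PQ mulmx1.
have /matrix0Pn[i [j vij]] : v *m Q != 0.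
  by apply: contraNneq v0 => vQ; rewrite -[v]mulmx1 -QP mulmxA vQ mul0mx.
exists j; move/matrixP/(_ i j): ev; rewrite mul_mx_diag [LHS]mxE [RHS]mxE mulrC.
by move/(mulIf vij).
Qed.

(** * Compression of the evolution to an eigenspace *)

Section Evolution.
Variables (R : realType) (n : nat) (A : 'M[R[i]]_n).
Hypotheses (A_sym : A^T = A) (A_real : A ^ Num.conj = A).

(** The exponential as a function of the spectrum. The real part lets a
    function of a real argument be applied to eigenvalues, which are real but
    have the type of complex numbers. *)
Lemma evolution_spectral (P Q : 'M[R[i]]_n) (d : 'rV[R[i]]_n) (t : R) :
  P *m Q = 1%:M -> Q *m P = 1%:M -> (forall j, d 0 j \is Num.real) ->
  expmx (('i * t%:C) *: (Q *m diag_mx d *m P))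
  = Q *m diag_mx (map_mx (fun x => phase (t * complex.Re x) : R[i]) d) *m P.
Proof.
move=> PQ QP d_real; apply: expmx_diag => // j.
rewrite mxE -{1}(RRe_real (d_real j)) -mulrA -rmorphM.
exact: cvg_phase.
Qed.

Lemma mulmx_exp_eigen (B : 'M[R[i]]_n) theta (t : R) :
  B *m A = theta *: B ->
  B *m expmx (('i * t%:C) *: A) = phase (t * complex.Re theta) *: B.
Proof.
have [P [Q [d [PQ QP d_real AE]]]] := real_symmetric_spectral A_sym A_real.
rewrite AE evolution_spectral // => BA.
exact: (eigen_mul_conj_diag (fun x => phase (t * complex.Re x)) PQ QP BA).
Qed.

Lemma exp_mulmx_eigen (B : 'M[R[i]]_n) theta (t : R) :
  A *m B = theta *: B ->
  expmx (('i * t%:C) *: A) *m B = phase (t * complex.Re theta) *: B.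
Proof.
have [P [Q [d [PQ QP d_real AE]]]] := real_symmetric_spectral A_sym A_real.
move=> /(congr1 trmx); rewrite trmx_mul linearZ /= AE => BA.
rewrite evolution_spectral //.
(* Transposition exchanges the roles of [P] and [Q]. *)
apply: trmx_inj; rewrite trmx_mul linearZ /=.
move: BA; rewrite !trmx_mul !tr_diag_mx !mulmxA => BA.
have := @eigen_mul_conj_diag _ _ _ (B^T) (Q^T) (P^T) d theta
  (fun x => phase (t * complex.Re x)).
by rewrite !mulmxA; apply=> //; rewrite -trmx_mul ?PQ ?QP trmx1.
Qed.

Lemma compress_evolution (E M : 'M[R[i]]_n) theta (t : R) :
  E *m A = theta *: E -> A *m E = theta *: E ->
  E *m (expmx (('i * t%:C) *: A) *m M *m expmx (('i * (- t)%:C) *: A)) *m E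
  = E *m M *m E.
Proof.
move=> /(mulmx_exp_eigen t) El /(exp_mulmx_eigen (- t)) Er.
rewrite !mulmxA El -(mulmxA _ _ E) Er mulNr.
by rewrite -!scalemxAl -scalemxAr scalerA phaseN scale1r.
Qed.
End Evolution.

(** * A threshold for finitely many nonnegative numbers *)

Lemma eq0_of_small (R : realType) (I : finType) (f : I -> R[i]) :
  (forall i, 0 <= f i) ->
  exists2 eta : R, 0 < eta & forall i, f i < eta%:C -> f i = 0.
Proof.
move=> f0; pose g i := complex.Re (f i).
have fg i : f i = (g i)%:C by rewrite RRe_real ?ger0_real.
(* The initial value [1] covers the case where every [f i] is zero. *)
exists (\big[Order.min/1]_(i | g i != 0) g i).
  apply: lt_bigmin => // i gi0; rewrite lt_neqAle eq_sym gi0 /=.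
  by rewrite -ler0c -fg.
move=> i; rewrite fg ltcR => h; apply/eqP; apply: contraTT h => fi0.
rewrite -leNgt; apply: bigmin_le_cond.
by apply: contraNneq fi0 => ->.
Qed.

(** * Graphs *)

Section Graph.
Variables (R : realType) (T : finType) (e : rel T).
Hypothesis e_sym : symmetric e.
Local Notation A := (adjmx R e).

Lemma adjmx_sym : A^T = A.
Proof. by apply/matrixP => i j; rewrite !mxE e_sym. Qed.

Lemma adjmx_real : A ^ Num.conj = A.
Proof. by apply/matrixP => i j; rewrite !mxE conjC_nat. Qed.

Lemma compress_vtx_state_at theta (a : T) (t : R) : theta \is Num.real ->
  eigenproj A theta *m vtx_state_at e a t *m eigenproj A theta
  = eigenproj A theta *m vtx_state R a *m eigenproj A theta.
Proof.
move=> th; have [As Ar] := (adjmx_sym, adjmx_real).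
apply: (@compress_evolution _ _ _ As Ar _ _ theta).
  exact: eigenproj_mulmx.
exact: mulmx_eigenproj.
Qed.

Lemma compress_vtx_state_eq theta (a b : T) : theta \is Num.real ->
  eigenproj A theta *m (vtx_state R a - vtx_state R b) *m eigenproj A theta = 0 ->
  eigenproj A theta *m vtx R a = eigenproj A theta *m vtx R b \/
  eigenproj A theta *m vtx R a = - (eigenproj A theta *m vtx R b).
Proof.
move=> th; have ET := eigenproj_symmetric adjmx_sym adjmx_real th.
move: (eigenproj _ _) ET => E ET.
have square c : (E *m vtx R c) *m (E *m vtx R c)^T = E *m vtx_state R c *m E.
  by rewrite trmx_mul ET /vtx_state !mulmxA.
rewrite mulmxBr mulmxBl => /subr0_eq ab; apply: outer_square_eq.
by rewrite !square.
Qed.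
End Graph.

Theorem lemma14p3 (R : realType) (T : finType) (e : rel T)
    (e_sym : symmetric e) (e_irr : irreflexive e) :
  exists eta : R, 0 < eta /\
    forall a b : T,
      (exists t : R, 0 <= t /\
         mxnorm_tr (vtx_state_at e a t - vtx_state R b) < eta%:C) ->
      strongly_cospectral R e a b.
Proof.
have [As Ar] := (adjmx_sym R e_sym, adjmx_real R e).
have [P [Q [d [PQ QP d_real AE]]]] := real_symmetric_spectral As Ar.
pose E j := eigenproj (adjmx R e) (d 0 j).
pose f (x : 'I_#|T| * T * T) :=
  mxnorm_tr (E x.1.1 *m (vtx_state R x.1.2 - vtx_state R x.2) *m E x.1.1).
have [eta eta0 etaP] := eq0_of_small (fun x => mxnorm_tr_ge0 _ : 0 <= f x).
exists eta; split=> // a b [t [_ tab]] theta.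
(* Every eigenvalue is a diagonal entry [d 0 j], so [eta] covers all of them. *)
rewrite {1}AE => /(eigenvalue_conj_diag PQ QP)[j ->].
apply: (compress_vtx_state_eq e_sym (d_real j)).
apply: mxnorm_tr_eq0; apply: (etaP (j, a, b)); apply: le_lt_trans tab.
rewrite /f /= mulmxBr mulmxBl -(compress_vtx_state_at e_sym a t) //.
rewrite -mulmxBl -mulmxBr; apply: mxnorm_tr_compress.
  exact: eigenproj_hermitian.
exact: eigenproj_idem.
Qed.
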